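(* Let $(A_1,\cdot)$ and $(A_2,\top)$ be left pre-Jacobi-Jordan algebras and let $\rho_1,\mu_1:A_1\to gl(A_2)$, $\rho_2,\mu_2:A_2\to gl(A_1)$ be linear maps. Then $(A_1,A_2,\rho_1,\mu_1,\rho_2,\mu_2)$ is a matched pair of left pre-Jacobi-Jordan algebras if and only if $(A_1\oplus A_2,\diamond)$ is a left pre-Jacobi-Jordan algebra, where for all $x,y\in A_1$, $a,b\in A_2$, $$(x+a)\diamond(y+b):=(x\cdot y+\rho_2(a)y+\mu_2(b)x)+(a\top b+\rho_1(x)b+\mu_1(y)a).$$
   Context: All vector spaces are finite dimensional over a field $\mathbb{K}$ of characteristic $0$; an algebra is a vector space with a bilinear product, not assumed associative, and $gl(V)$ is the space of linear endomorphisms of $V$. A left pre-Jacobi-Jordan algebra is an algebra $(A,\cdot)$ whose anti-associator $Aasso(x,y,z):=(x\cdot y)\cdot z+x\cdot(y\cdot z)$ satisfies $Aasso(x,y,z)=-Aasso(y,x,z)$ for all $x,y,z\in A$. A representation of a left pre-Jacobi-Jordan algebra $(A,\cdot)$ on a vector space $V$ is a pair of linear maps $\rho,\mu:A\to gl(V)$ with $$\rho(x\cdot y+y\cdot x)=-\rho(x)\rho(y)-\rho(y)\rho(x),\qquad \mu(y)\mu(x)+\mu(x\cdot y)=-\mu(y)\rho(x)-\rho(x)\mu(y)$$ for all $x,y\in A$. A matched pair of left pre-Jacobi-Jordan algebras $(A_1,A_2,\rho_1,\mu_1,\rho_2,\mu_2)$ consists of two left pre-Jacobi-Jordan algebras $(A_1,\cdot)$,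 $(A_2,\top)$ together with a representation $(\rho_1,\mu_1)$ of $A_1$ on $A_2$ and a representation $(\rho_2,\mu_2)$ of $A_2$ on $A_1$ such that for all $x,y\in A_1$, $a,b\in A_2$, writing $x\ast y:=x\cdot y+y\cdot x$ and $a\circledast b:=a\top b+b\top a$: $$\rho_1(x)(a\top b)=-\rho_1(\rho_2(a)x+\mu_2(a)x)b-(\rho_1(x)a+\mu_1(x)a)\top b-\mu_1(\mu_2(b)x)a-a\top(\rho_1(x)b),$$ $$\mu_1(x)(a\circledast b)=-a\top(\mu_1(x)b)-b\top(\mu_1(x)a)-\mu_1(\rho_2(a)x)b-\mu_1(\rho_2(b)x)a,$$ $$\rho_2(a)(x\cdot y)=-\rho_2(\rho_1(x)a+\mu_1(x)a)y-(\rho_2(a)x+\mu_2(a)x)\cdot y-\mu_2(\mu_1(y)a)x-x\cdot(\rho_2(a)y),$$ $$\mu_2(a)(x\ast y)=-x\cdot(\mu_2(a)y)-y\cdot(\mu_2(a)x)-\mu_2(\rho_1(x)a)y-\mu_2(\rho_1(y)a)x.$$ *)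

(* Defs.v *)
From mathcomp Require Import all_boot all_order all_algebra.

Set Implicit Arguments.
Unset Strict Implicit.
Unset Printing Implicit Defensive.

Import GRing.Theory.
Local Open Scope ring_scope.

(* An algebra is a vector space with a bilinear product, not assumed
   associative; the product is a plain function and its bilinearity is part of
   the predicates below. [bilinear_for] is Type-valued, hence the conjunction. *)
Definition bilinear_product (K : fieldType) (A : vectType K)
    (mul : A -> A -> A) : Prop :=
  (forall y : A, linear (mul ^~ y)) /\ (forall x : A, linear (mul x)).

Definition antiassociator (K : fieldType) (A : vectType K)
    (mul : A -> A -> A) (x y z : A) : A :=
  mul (mul x y) z + mul x (mul y z).

Record left_pre_jacobi_jordan (K : fieldType) (A : vectType K)
    (mul : A -> A -> A) : Prop := LeftPreJacobiJordan {
  left_pre_jj_bilinear : bilinear_product mul;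
  left_pre_jj_antiassociator : forall x y z : A,
    antiassociator mul x y z = - antiassociator mul y x z
}.

(* gl(V) is 'End(V), and \o is composition of endomorphisms. *)
Record left_pre_jj_representation (K : fieldType) (A V : vectType K)
    (mul : A -> A -> A) (rho mu : {linear A -> 'End(V)}) : Prop :=
  LeftPreJJRepresentation {
  left_pre_jj_rep_rho : forall x y : A,
    rho (mul x y + mul y x)
    = - (rho x \o rho y)%VF - (rho y \o rho x)%VF;
  left_pre_jj_rep_mu : forall x y : A,
    (mu y \o mu x)%VF + mu (mul x y)
    = - (mu y \o rho x)%VF - (rho x \o mu y)%VF
}.

Record left_pre_jj_matched_pair (K : fieldType) (A1 A2 : vectType K)
    (mul1 : A1 -> A1 -> A1) (mul2 : A2 -> A2 -> A2)
    (rho1 mu1 : {linear A1 -> 'End(A2)})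
    (rho2 mu2 : {linear A2 -> 'End(A1)}) : Prop := LeftPreJJMatchedPair {
  matched_pair_alg1 : left_pre_jacobi_jordan mul1;
  matched_pair_alg2 : left_pre_jacobi_jordan mul2;
  matched_pair_rep1 : left_pre_jj_representation mul1 rho1 mu1;
  matched_pair_rep2 : left_pre_jj_representation mul2 rho2 mu2;
  matched_pair_rho1 : forall (x : A1) (a b : A2),
    rho1 x (mul2 a b)
    = - rho1 (rho2 a x + mu2 a x) b - mul2 (rho1 x a + mu1 x a) b
      - mu1 (mu2 b x) a - mul2 a (rho1 x b);
  matched_pair_mu1 : forall (x : A1) (a b : A2),
    mu1 x (mul2 a b + mul2 b a)
    = - mul2 a (mu1 x b) - mul2 b (mu1 x a)
      - mu1 (rho2 a x) b - mu1 (rho2 b x) a;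
  matched_pair_rho2 : forall (a : A2) (x y : A1),
    rho2 a (mul1 x y)
    = - rho2 (rho1 x a + mu1 x a) y - mul1 (rho2 a x + mu2 a x) y
      - mu2 (mu1 y a) x - mul1 x (rho2 a y);
  matched_pair_mu2 : forall (a : A2) (x y : A1),
    mu2 a (mul1 x y + mul1 y x)
    = - mul1 x (mu2 a y) - mul1 y (mu2 a x)
      - mu2 (rho1 x a) y - mu2 (rho1 y a) x
}.

(* The direct sum of A1 and A2 is the product vector space A1 * A2, with x + a
   encoded as the pair (x, a). *)
Definition bicrossed_product (K : fieldType) (A1 A2 : vectType K)
    (mul1 : A1 -> A1 -> A1) (mul2 : A2 -> A2 -> A2)
    (rho1 mu1 : A1 -> 'End(A2)) (rho2 mu2 : A2 -> 'End(A1))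
    (u v : A1 * A2) : A1 * A2 :=
  let: (x, a) := u in let: (y, b) := v in
  (mul1 x y + rho2 a y + mu2 b x, mul2 a b + rho1 x b + mu1 y a).

(* Main.v *)
(** The antiassociator identity says that the trilinear map
    [(u, v, w) |-> (u v + v u) w + u (v w) + v (u w)], symmetric in [u] and [v],
    vanishes. On a direct sum it is enough to test it on pure triples; up to the
    symmetry there are six kinds of them, and the two components of the values
    on the mixed ones are exactly the axioms of representations and of matched
    pairs. *)
Require Import Defs.
From mathcomp Require Import all_boot all_order all_algebra.

Import GRing.Theory.
Local Open Scope ring_scope.

Set Implicit Arguments.
Unset Strict Implicit.

Section Bilinear.
Variables (K : fieldType) (A : vectType K) (mul : A -> A -> A).
Hypothesis mulP : bilinear_product mul.

Lemma bilinear_productDl x y z : mul (x + y) z = mul x z + mul y z.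
Proof. by have := mulP.1 z 1 x y; rewrite !scale1r. Qed.

Lemma bilinear_productDr x y z : mul x (y + z) = mul x y + mul x z.
Proof. by have := mulP.2 x 1 y z; rewrite !scale1r. Qed.

Lemma bilinear_product0l x : mul 0 x = 0.
Proof. by apply: (addrI (mul 0 x)); rewrite -bilinear_productDl !addr0. Qed.

Lemma bilinear_product0r x : mul x 0 = 0.
Proof. by apply: (addrI (mul x 0)); rewrite -bilinear_productDr !addr0. Qed.

(** By bilinearity this is the antiassociator at [(x, y, z)] plus the one at [(y, x, z)]. The
    anticommutator stays a single left factor because the axioms apply the [rho] and [mu] maps to it
    as a whole. *)
Definition left_pre_jj_defect x y z : A :=
  mul (mul x y + mul y x) z + (mul x (mul y z) + mul y (mul x z)).

Lemma left_pre_jj_defectC x y z :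
  left_pre_jj_defect x y z = left_pre_jj_defect y x z.
Proof.
by rewrite /left_pre_jj_defect [mul x y + _]addrC [mul x (mul y z) + _]addrC.
Qed.

Lemma left_pre_jj_defectDl x x' y z :
  left_pre_jj_defect (x + x') y z
  = left_pre_jj_defect x y z + left_pre_jj_defect x' y z.
Proof.
rewrite /left_pre_jj_defect !(bilinear_productDl, bilinear_productDr).
by rewrite (AC ((2*2)*(2*2)) (((1*3)*(5*7))*((2*4)*(6*8)))).
Qed.

Lemma left_pre_jj_defectDm x y y' z :
  left_pre_jj_defect x (y + y') z
  = left_pre_jj_defect x y z + left_pre_jj_defect x y' z.
Proof. by rewrite !(left_pre_jj_defectC x) left_pre_jj_defectDl. Qed.

Lemma left_pre_jj_defectDr x y z z' :
  left_pre_jj_defect x y (z + z')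
  = left_pre_jj_defect x y z + left_pre_jj_defect x y z'.
Proof.
rewrite /left_pre_jj_defect !bilinear_productDr.
by rewrite (AC (2*(2*2)) ((1*(3*5))*(2*(4*6)))).
Qed.

Lemma left_pre_jacobi_jordanE :
  left_pre_jacobi_jordan mul
  <-> forall x y z, left_pre_jj_defect x y z = 0.
Proof.
have defectE x y z : left_pre_jj_defect x y z
    = antiassociator mul x y z + antiassociator mul y x z.
  rewrite /left_pre_jj_defect /antiassociator bilinear_productDl.
  by rewrite (AC (2*2) ((1*3)*(2*4))).
split=> [[_ jj] x y z|jj]; first by rewrite defectE jj addNr.
by split=> // x y z; apply/eqP; rewrite -addr_eq0 -defectE jj.
Qed.

End Bilinear.

Section Rearrange.
Variable V : zmodType.
Implicit Types p q r s t : V.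

Lemma eq_oppE p q : p = - q <-> p + q = 0.
Proof. by split=> [->|/eqP]; [rewrite addNr|rewrite addr_eq0 => /eqP]. Qed.

(** Shape of the [rho] axiom of a representation. *)
Lemma eq_opp2 p q r : p = - q - r <-> p + (q + r) = 0.
Proof. by rewrite -opprD; apply: eq_oppE. Qed.

(** Shape of the [mu] axiom of a representation; on the right the terms stand in the order in which
    the defect produces them. *)
Lemma eq_add_opp2 p q r s : p + q = - r - s <-> (r + p) + (s + q) = 0.
Proof.
rewrite [_ + (s + q)](AC (2*2) ((2*4)*(1*3))) -opprD; exact: eq_oppE.
Qed.

(** Shape of the matched pair axioms for [mu1] and [mu2]: the defect pairs the outer terms [q], [t]
    and the inner terms [r], [s]. *)
Lemma eq_opp4_outer p q r s t :
  p = - q - r - s - t <-> p + ((q + t) + (r + s)) = 0.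
Proof. rewrite (AC (2*2) (((1*3)*4)*2)) -!opprD; exact: eq_oppE. Qed.

(** Shape of the matched pair axioms for [rho1] and [rho2]: the left side [p] of the axiom comes
    last in the defect. *)
Lemma eq_opp4_last p q r s t :
  p = - q - r - s - t <-> (r + q) + ((t + s) + p) = 0.
Proof.
rewrite [_ + (_ + p)](AC (2*(2*1)) (5*(((2*1)*4)*3))) -!opprD; exact: eq_oppE.
Qed.

End Rearrange.

Section BicrossedProduct.
Variables (K : fieldType) (A1 A2 : vectType K).
Variables (mul1 : A1 -> A1 -> A1) (mul2 : A2 -> A2 -> A2).
Variables (rho1 mu1 : {linear A1 -> 'End(A2)}).
Variables (rho2 mu2 : {linear A2 -> 'End(A1)}).
Hypotheses (mul1P : bilinear_product mul1) (mul2P : bilinear_product mul2).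

Let mul : (A1 * A2)%type -> (A1 * A2)%type -> (A1 * A2)%type :=
  bicrossed_product mul1 mul2 rho1 mu1 rho2 mu2.

Lemma bicrossed_product_bilinear : bilinear_product mul.
Proof.
split=> [[y b] k [x a] [x' a']|[x a] k [y b] [y' b']].
  congr pair => /=.
    rewrite mul1P.1 !linearP !add_lfunE !scale_lfunE !scalerDr.
    by rewrite (AC (2*2*2) ((1*3*5)*(2*4*6))).
  rewrite mul2P.1 !linearP !add_lfunE !scale_lfunE !scalerDr.
  by rewrite (AC (2*2*2) ((1*3*5)*(2*4*6))).
congr pair => /=.
  rewrite mul1P.2 !linearP !add_lfunE !scale_lfunE !scalerDr.
  by rewrite (AC (2*2*2) ((1*3*5)*(2*4*6))).
rewrite mul2P.2 !linearP !add_lfunE !scale_lfunE !scalerDr.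
by rewrite (AC (2*2*2) ((1*3*5)*(2*4*6))).
Qed.

Let simp := (bilinear_product0l mul1P, bilinear_product0r mul1P,
  bilinear_product0l mul2P, bilinear_product0r mul2P, linear0,
  zero_lfunE, addr0, add0r).

Lemma pair_add (x y : A1) (a b : A2) : (x, a) + (y, b) = (x + y, a + b).
Proof. by []. Qed.

(** [A1] is a subalgebra of the direct sum, so these triples only see the identity of [A1]. *)
Lemma bicrossed_defect111 x y z :
  left_pre_jj_defect mul (x, 0) (y, 0) (z, 0)
  = (left_pre_jj_defect mul1 x y z, 0).
Proof. by rewrite /left_pre_jj_defect /= !simp !pair_add ?simp. Qed.

Lemma bicrossed_defect222 a b c :
  left_pre_jj_defect mul (0, a) (0, b) (0, c)
  = (0, left_pre_jj_defect mul2 a b c).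
Proof. by rewrite /left_pre_jj_defect /= !simp !pair_add ?simp. Qed.

(** The first component encodes the matched pair axiom for [mu2], the second the [rho] axiom of the
    representation on [A2]. *)
Lemma bicrossed_defect112 x y c :
  left_pre_jj_defect mul (x, 0) (y, 0) (0, c)
  = (mu2 c (mul1 x y + mul1 y x)
       + ((mul1 x (mu2 c y) + mu2 (rho1 y c) x)
          + (mul1 y (mu2 c x) + mu2 (rho1 x c) y)),
     rho1 (mul1 x y + mul1 y x) c
       + (rho1 x (rho1 y c) + rho1 y (rho1 x c))).
Proof. by rewrite /left_pre_jj_defect /= !simp !pair_add ?simp. Qed.

Lemma bicrossed_defect221 a b z :
  left_pre_jj_defect mul (0, a) (0, b) (z, 0)
  = (rho2 (mul2 a b + mul2 b a) z
       + (rho2 a (rho2 b z) + rho2 b (rho2 a z)),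
     mu1 z (mul2 a b + mul2 b a)
       + ((mul2 a (mu1 z b) + mu1 (rho2 b z) a)
          + (mul2 b (mu1 z a) + mu1 (rho2 a z) b))).
Proof. by rewrite /left_pre_jj_defect /= !simp !pair_add ?simp. Qed.

(** The first component encodes the matched pair axiom for [rho2], the second the [mu] axiom of the
    representation on [A2]. Exchanging the roles of the two algebras also exchanges the
    components. *)
Lemma bicrossed_defect121 x b z :
  left_pre_jj_defect mul (x, 0) (0, b) (z, 0)
  = ((mul1 (rho2 b x + mu2 b x) z + rho2 (rho1 x b + mu1 x b) z)
       + ((mul1 x (rho2 b z) + mu2 (mu1 z b) x) + rho2 b (mul1 x z)),
     (mu1 z (rho1 x b) + mu1 z (mu1 x b))
       + (rho1 x (mu1 z b) + mu1 (mul1 x z) b)).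
Proof.
rewrite /left_pre_jj_defect /= !simp !pair_add ?simp.
(* The sum is put in the order of the [rho2] axiom, and [mu1 z] is distributed because the [mu]
   axiom lists the two composites separately. *)
by rewrite [mu2 b x + _]addrC (linearD (mu1 z)).
Qed.

Lemma bicrossed_defect212 a y c :
  left_pre_jj_defect mul (0, a) (y, 0) (0, c)
  = ((mu2 c (rho2 a y) + mu2 c (mu2 a y))
       + (rho2 a (mu2 c y) + mu2 (mul2 a c) y),
     (mul2 (rho1 y a + mu1 y a) c + rho1 (rho2 a y + mu2 a y) c)
       + ((mul2 a (rho1 y c) + mu1 (mu2 c y) a) + rho1 y (mul2 a c))).
Proof.
rewrite /left_pre_jj_defect /= !simp !pair_add ?simp.
by rewrite [mu1 y a + _]addrC (linearD (mu2 c)).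
Qed.

Lemma bicrossed_defect_eq0 :
  (forall x y z, left_pre_jj_defect mul (x, 0) (y, 0) (z, 0) = 0) ->
  (forall x y c, left_pre_jj_defect mul (x, 0) (y, 0) (0, c) = 0) ->
  (forall x b z, left_pre_jj_defect mul (x, 0) (0, b) (z, 0) = 0) ->
  (forall a y c, left_pre_jj_defect mul (0, a) (y, 0) (0, c) = 0) ->
  (forall a b z, left_pre_jj_defect mul (0, a) (0, b) (z, 0) = 0) ->
  (forall a b c, left_pre_jj_defect mul (0, a) (0, b) (0, c) = 0) ->
  forall u v w, left_pre_jj_defect mul u v w = 0.
Proof.
move=> d111 d112 d121 d212 d221 d222 u v w.
have decomp (t : A1 * A2) : t = (t.1, 0) + (0, t.2).
  by case: t => x a; rewrite pair_add addr0 add0r.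
have mulP := bicrossed_product_bilinear.
rewrite (decomp u) (decomp v) (decomp w).
rewrite !(left_pre_jj_defectDl mulP, left_pre_jj_defectDm mulP,
  left_pre_jj_defectDr mulP).
(* Trilinearity leaves eight pure triples; symmetry in the first two arguments turns kind 211 into
   121 and kind 122 into 212. *)
rewrite (left_pre_jj_defectC mul (0, u.2) (v.1, 0) (w.1, 0)).
rewrite (left_pre_jj_defectC mul (u.1, 0) (0, v.2) (0, w.2)).
by rewrite d111 d112 !d121 !d212 d221 d222 !addr0.
Qed.

End BicrossedProduct.

Theorem theorem2p17 (K : fieldType) (charK : [pchar K] =i pred0)
    (A1 A2 : vectType K) (mul1 : A1 -> A1 -> A1) (mul2 : A2 -> A2 -> A2)
    (hA1 : left_pre_jacobi_jordan mul1) (hA2 : left_pre_jacobi_jordan mul2)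
    (rho1 mu1 : {linear A1 -> 'End(A2)}) (rho2 mu2 : {linear A2 -> 'End(A1)}) :
  left_pre_jj_matched_pair mul1 mul2 rho1 mu1 rho2 mu2
  <-> left_pre_jacobi_jordan
        (bicrossed_product mul1 mul2 rho1 mu1 rho2 mu2 :
           (A1 * A2)%type -> (A1 * A2)%type -> (A1 * A2)%type).
Proof.
have [mul1P _] := hA1; have [mul2P _] := hA2.
have mulP := bicrossed_product_bilinear rho1 mu1 rho2 mu2 mul1P mul2P.
have jj1 := (left_pre_jacobi_jordanE mul1P).1 hA1.
have jj2 := (left_pre_jacobi_jordanE mul2P).1 hA2.
(* Bilinearity of the bicrossed product is already known, so its side of the equivalence becomes the
   vanishing of the defect. *)
apply: iff_trans (iff_sym (left_pre_jacobi_jordanE mulP)); split.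
  case=> _ _ [rho1P mu1P] [rho2P mu2P] mrho1 mmu1 mrho2 mmu2.
  apply: bicrossed_defect_eq0 => // [x y z|x y c|x b z|a y c|a b z|a b c].
  - by rewrite bicrossed_defect111 // jj1.
  - rewrite bicrossed_defect112 //; congr pair.
      by apply/eq_opp4_outer/mmu2.
    apply/eq_opp2.
    by rewrite rho1P !(add_lfunE, opp_lfunE, comp_lfunE).
  - rewrite bicrossed_defect121 //; congr pair.
      by apply/eq_opp4_last/mrho2.
    (* The axiom equates endomorphisms of [A2]; it is evaluated at [b]. *)
    apply/eq_add_opp2; have /lfunP/(_ b) := mu1P x z.
    by rewrite !(add_lfunE, opp_lfunE, comp_lfunE).
  - rewrite bicrossed_defect212 //; congr pair; last first.
      by apply/eq_opp4_last/mrho1.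
    apply/eq_add_opp2; have /lfunP/(_ y) := mu2P a c.
    by rewrite !(add_lfunE, opp_lfunE, comp_lfunE).
  - rewrite bicrossed_defect221 //; congr pair; last first.
      by apply/eq_opp4_outer/mmu1.
    apply/eq_opp2.
    by rewrite rho2P !(add_lfunE, opp_lfunE, comp_lfunE).
  - by rewrite bicrossed_defect222 // jj2.
move=> jj.
(* Conversely, each axiom is read off from one component of the defect on one of the four mixed
   kinds of triples. *)
have d112 x y c := jj (x, 0) (y, 0) (0, c).
have d121 x b z := jj (x, 0) (0, b) (z, 0).
have d212 a y c := jj (0, a) (y, 0) (0, c).
have d221 a b z := jj (0, a) (0, b) (z, 0).
split=> //; first split.
- move=> x y; apply/lfunP=> c.
  rewrite !(add_lfunE, opp_lfunE, comp_lfunE).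
  by apply/eq_opp2; have := d112 x y c; rewrite bicrossed_defect112 // => -[].
- move=> x y; apply/lfunP=> b.
  rewrite !(add_lfunE, opp_lfunE, comp_lfunE); apply/eq_add_opp2.
  by have := d121 x b y; rewrite bicrossed_defect121 // => -[].
- split=> a b; apply/lfunP=> z; rewrite !(add_lfunE, opp_lfunE, comp_lfunE).
    by apply/eq_opp2; have := d221 a b z; rewrite bicrossed_defect221 // => -[].
  by apply/eq_add_opp2; have := d212 a z b; rewrite bicrossed_defect212 // => -[].
- move=> x a b; apply/eq_opp4_last.
  by have := d212 a x b; rewrite bicrossed_defect212 // => -[].
- move=> x a b; apply/eq_opp4_outer.
  by have := d221 a b x; rewrite bicrossed_defect221 // => -[].
- move=> a x y; apply/eq_opp4_last.
  by have := d121 x a y; rewrite bicrossed_defect121 // => -[].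
- move=> a x y; apply/eq_opp4_outer.
  by have := d112 x y a; rewrite bicrossed_defect112 // => -[].
Qed.
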